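(* For the $K_r$-bootstrap percolation process: \begin{itemize} \item for every $n \geq 2$, $\tau_{\max}(n,3) = \lceil \log_2 (n-1) \rceil$; \item for every $n \geq 3$, $\tau_{\max}(n,4) = n-3$; \item for every fixed $r \geq 5$, $\tau_{\max}(n,r) = \Omega(n^{3/2})$ as $n \to \infty$, i.e. there are constants $c=c(r)>0$ and $n_0$ such that $\tau_{\max}(n,r) \geq c\, n^{3/2}$ for all $n \geq n_0$. \end{itemize}
   Context: Fix an integer $r \geq 3$. The $K_r$-bootstrap percolation process on $K_n$ (vertex set $[n]$) is defined as follows: given a set of initially active edges $G \subseteq E(K_n)$ (identified with the graph on $[n]$ with these edges), set $G_0 := G$ and for every integer $t \geq 0$, $G_{t+1} := G_t \cup \{ e \in E(K_n) : \text{there is a copy } H \text{ of } K_r \text{ with } e \in H \subseteq G_t \cup \{e\}\}$, i.e. an edge is added at time $t+1$ if it is the only missing edge of some $r$-clique in $G_t$. Write $\langle G\rangle_t := G_t$ and $\langle G \rangle_{K_r} := \bigcup_{t} G_t$. The saturation time of $G$ is $\tau_r(G) := \min\{t \geq 0 : \langle G \rangle_t = \langle G \rangle_{K_r}\}$, and the maximum saturation time is $\tau_{\max}(n,r) := \max\{\tau_r(G) : G \text{ a graph on } n \text{ vertices}\}$. *)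

(* Defs.v *)
From Stdlib Require Import Reals.
From mathcomp Require Import all_boot.
From mathcomp Require Import boolp.
Set Implicit Arguments. Unset Strict Implicit. Unset Printing Implicit Defensive.

Definition is_edge n (e : {set 'I_n}) : bool := #|e| == 2.

Definition is_graph n (G : {set {set 'I_n}}) : bool := [forall e in G, is_edge e].

(* One step of K_r-bootstrap percolation:
   G_{t+1} = G_t ∪ {e : exists an r-set S ⊇ e all of whose pairs other than e
   are in G_t}  (i.e. a copy of K_r with e ∈ H ⊆ G_t ∪ {e}). *)
Definition perc_step (r n : nat) (G : {set {set 'I_n}}) : {set {set 'I_n}} :=
  G :|: [set e | is_edge e &&
          [exists S : {set 'I_n}, (#|S| == r) && (e \subset S) &&
             [forall f : {set 'I_n}, (is_edge f && (f \subset S) && (f != e)) ==> (f \in G)]]].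

Definition perc_iter (r n t : nat) (G : {set {set 'I_n}}) : {set {set 'I_n}} :=
  ssrnat.iter t (@perc_step r n) G.

Definition perc_closure (r n : nat) (G : {set {set 'I_n}}) : {set {set 'I_n}} :=
  [set e | `[< exists t, e \in perc_iter r t G >]].

Definition is_sat_time (r n : nat) (G : {set {set 'I_n}}) (t : nat) : Prop :=
  perc_iter r t G = perc_closure r G /\
  (forall s, s < t -> perc_iter r s G <> perc_closure r G).

Definition is_tau_max (n r m : nat) : Prop :=
  (exists G : {set {set 'I_n}}, is_graph G /\ is_sat_time r G m) /\
  (forall (G : {set {set 'I_n}}) t, is_graph G -> is_sat_time r G t -> t <= m).

Definition ceil_log2 (m : nat) : nat := up_log 2 m.

(* Main.v *)
Require Import Defs.
From Stdlib Require Import Reals ZArith Lra.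
From mathcomp Require Import all_boot.
From mathcomp Require Import boolp zify.
Set Implicit Arguments. Unset Strict Implicit. Unset Printing Implicit Defensive.

(**
r = 3: after t steps the active edges are the pairs at distance at most 2^t in
the initial graph, and the diameter of a component is at most n - 1, with
equality for a path.

r = 4: an edge appearing at time t has its ends in, or joined by two edges to,
a clique of size at least t + 3 of the graph at time t, so t + 3 <= n.
Conversely, start from a triangle 0, 1, 2 and join every k >= 3 to k - 1 and to
the parity of k: the clique on 0, ..., t + 2 grows by exactly one vertex per step.

r >= 5: a chain of r-cliques H_1, ..., H_T in which consecutive cliques share an
edge e_k, with no other near-clique in their union, runs for T steps.  For r = 5
let H_k consist of Red and Green vertices labelled k - 1 and k and an Apex
labelled k, where labels are read modulo m, m + 4 and m + 8B + 4 respectively,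
with m = 16B^2 + 16B + 4, and T = Bm.  No combination of the three moduli with
coefficients at most 2B is small unless it is trivial, so every triangle of the
union whose vertices do not all have the same colour lifts to an honest triangle
of the unwrapped infinite strip, and the only near-cliques are the H_k.  There
are O(B^2) vertices and T >= 16B^3.  For larger r add r - 5 universal vertices.
*)

(** * The percolation process *)

Section Process.

Variables (r n : nat).
Implicit Types (G : {set {set 'I_n}}) (x y z : 'I_n) (S e : {set 'I_n}).

Lemma is_edgeP e : reflect (exists x y, x != y /\ e = [set x; y]) (is_edge e).
Proof.
exact: cards2P.
Qed.

Lemma is_edge2 x y : is_edge [set x; y] = (x != y).
Proof. by rewrite /is_edge cards2; case: (x != y). Qed.

Lemma set2C x y : [set x; y] = [set y; x].
Proof. exact: setUC. Qed.

Lemma set2_inj x y u v :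
  [set x; y] = [set u; v] -> (x = u /\ y = v) \/ (x = v /\ y = u).
Proof.
move=> E.
have /set2P hx : x \in [set u; v] by rewrite -E set21.
have /set2P hy : y \in [set u; v] by rewrite -E set22.
have /set2P hu : u \in [set x; y] by rewrite E set21.
have /set2P hv : v \in [set x; y] by rewrite E set22.
by case: hx => ?; case: hy => ?; case: hu => ?; case: hv => ?; subst; auto.
Qed.

Lemma is_graphP G : reflect (forall e, e \in G -> is_edge e) (is_graph G).
Proof. exact: forall_inP. Qed.

Lemma perc_stepP G e :
  reflect (e \in G \/ is_edge e /\ exists2 S : {set 'I_n}, #|S| = r /\ e \subset S &
             forall f : {set 'I_n}, is_edge f -> f \subset S -> f != e -> f \in G)
          (e \in perc_step r G).
Proof.
rewrite /perc_step in_setU inE; apply: (iffP orP); case=> H; try by left.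
- right; case/andP: H => he /existsP[S /andP[/andP[/eqP hS eS] /forallP hf]].
  split=> //; exists S => // f h1 h2 h3.
  by move: (hf f); rewrite h1 h2 h3.
- right; case: H => he [S [hS eS] hf]; rewrite he /=.
  apply/existsP; exists S; rewrite hS eqxx eS /=.
  by apply/forallP=> f; apply/implyP=> /andP[/andP[h1 h2] h3]; apply: hf.
Qed.

Lemma perc_iterS t G : perc_iter r t.+1 G = perc_step r (perc_iter r t G).
Proof. by []. Qed.

Lemma perc_step_sub G : G \subset perc_step r G.
Proof. exact: subsetUl. Qed.

Lemma perc_iter_mono s t G :
  s <= t -> perc_iter r s G \subset perc_iter r t G.
Proof.
move=> /subnKC <-; elim: (t - s) => [|k IH]; first by rewrite addn0.
by rewrite addnS perc_iterS (subset_trans IH) // perc_step_sub.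
Qed.

Lemma perc_iter_graph t G : is_graph G -> is_graph (perc_iter r t G).
Proof.
move=> /is_graphP hG; elim: t => [|t /is_graphP IH]; apply/is_graphP=> // e.
by rewrite perc_iterS => /perc_stepP[/IH|[]].
Qed.

Lemma perc_closureP G e :
  reflect (exists t, e \in perc_iter r t G) (e \in perc_closure r G).
Proof. by rewrite inE; apply: asboolP. Qed.

Lemma perc_iter_sub_closure t G : perc_iter r t G \subset perc_closure r G.
Proof. by apply/subsetP=> e he; apply/perc_closureP; exists t. Qed.

Lemma perc_closure_eq t G :
  perc_closure r G \subset perc_iter r t G -> perc_iter r t G = perc_closure r G.
Proof. by move=> h; apply/eqP; rewrite eqEsubset h perc_iter_sub_closure. Qed.

Lemma perc_iter_stable t G :
  perc_step r (perc_iter r t G) = perc_iter r t G ->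
  perc_iter r t G = perc_closure r G.
Proof.
move=> st; apply: perc_closure_eq; apply/subsetP=> e /perc_closureP[s].
case: (leqP s t) => [st'|ts]; first exact: (subsetP (perc_iter_mono G st')).
suff -> : perc_iter r s G = perc_iter r t G by [].
rewrite -(subnKC (ltnW ts)); elim: (s - t) => [|k IH]; first by rewrite addn0.
by rewrite addnS perc_iterS IH.
Qed.

Lemma sat_time_strict t s G :
  is_sat_time r G t -> s < t -> perc_iter r s.+1 G != perc_iter r s G.
Proof.
move=> [_ h] st; apply/negP=> /eqP E; apply: (h s st); exact: perc_iter_stable.
Qed.

Lemma sat_time_exists G : exists t, is_sat_time r G t.
Proof.
have [t0 ht0] : exists t, perc_iter r t G == perc_closure r G.
  suff [t ht] : exists t, perc_closure r G \subset perc_iter r t G.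
    by exists t; apply/eqP; apply: perc_closure_eq.
  (* There are finitely many candidate edges, so the largest of their activation times serves for
     all of them. *)
  have /choice[T hT] : forall e, exists t,
      (e \in perc_closure r G) ==> (e \in perc_iter r t G).
    move=> e; case: (boolP (e \in _)) => [/perc_closureP[t ht]|_].
      by exists t.
    by exists 0.
  exists (\max_e T e); apply/subsetP=> e he.
  move: (hT e); rewrite he /=; apply/subsetP; apply: perc_iter_mono.
  exact: leq_bigmax.
have ex : exists t, perc_iter r t G == perc_closure r G by exists t0.
exists (ex_minn ex); case: ex_minnP => t /eqP h hmin; split=> // s st /eqP hs.
by move: (hmin s hs); lia.
Qed.

Lemma sat_time_ge T t G :
  (forall s, s < T -> perc_iter r s.+1 G <> perc_iter r s G) ->
  is_sat_time r G t -> T <= t.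
Proof.
move=> h [ht _]; rewrite leqNgt; apply/negP=> /h; apply.
apply/eqP; rewrite eqEsubset; apply/andP; split.
  by move: (perc_iter_sub_closure t.+1 G); rewrite -ht.
exact: perc_iter_mono.
Qed.

Definition graph_of (e : rel 'I_n) : {set {set 'I_n}} :=
  [set f | [exists x, exists y, [&& x != y, e x y & f == [set x; y]]]].

Lemma graph_ofP (e : rel 'I_n) x y : symmetric e ->
  ([set x; y] \in graph_of e) = (x != y) && e x y.
Proof.
move=> se; rewrite inE; apply/existsP/andP.
  move=> [u /existsP[v /and3P[uv euv /eqP /set2_inj]]].
  by case=> -[-> ->]; split=> //; rewrite 1?se // eq_sym.
by move=> [xy exy]; exists x; apply/existsP; exists y; rewrite xy exy /=.
Qed.

Lemma graph_of_graph (e : rel 'I_n) : is_graph (graph_of e).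
Proof.
apply/is_graphP=> f; rewrite inE => /existsP[x /existsP[y /and3P[xy _ /eqP->]]].
by rewrite is_edge2.
Qed.

End Process.

(** * K_3 *)

Section Triangle.

Variable n : nat.
Implicit Types (G : {set {set 'I_n}}) (x y z : 'I_n).

Lemma perc_step3 G x y : x != y ->
  reflect ([set x; y] \in G \/
           exists z, [/\ z != x, z != y, [set x; z] \in G & [set z; y] \in G])
          ([set x; y] \in perc_step 3 G).
Proof.
move=> xy; apply: (iffP (perc_stepP _ _ _)); case=> H; try by left.
- right; case: H => _ [S [hS eS] hf].
  have /card_gt0P[z] : 0 < #|S :\: [set x; y]|.
    by rewrite cardsD (setIidPr eS) hS cards2 xy.
  rewrite inE in_set2 negb_or => /andP[/andP[zx zy] zS].
  have xS : x \in S by apply: (subsetP eS); rewrite set21.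
  have yS : y \in S by apply: (subsetP eS); rewrite set22.
  exists z; split=> //; apply: hf; rewrite ?is_edge2 1?eq_sym //.
  + by apply/subsetP=> u /set2P[] ->.
  + by rewrite eq_sym; apply/eqP=> /set2_inj[][??]; subst; rewrite eqxx in zx zy.
  + by rewrite eq_sym.
  + by apply/subsetP=> u /set2P[] ->.
  + by rewrite eq_sym; apply/eqP=> /set2_inj[][??]; subst; rewrite eqxx in zx zy.
- right; case: H => z [zx zy xz zG]; split; first by rewrite is_edge2.
  exists (z |: [set x; y]).
    split; last exact: subsetUr.
    by rewrite cardsU1 cards2 xy !inE (negbTE zx) (negbTE zy).
  move=> f /is_edgeP[u [v [uv ->]]] /subsetP hs ne.
  have := hs u (set21 _ _); have := hs v (set22 _ _).
  rewrite !inE => /or3P[]/eqP Ev /or3P[]/eqP Eu; move: uv ne;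
    rewrite Eu Ev ?eqxx // => _; rewrite ?(set2C y x) ?eqxx // => _;
    by rewrite // set2C.
Qed.

Definition adjacency G : rel 'I_n := [rel x y | (x != y) && ([set x; y] \in G)].

(** Length at most [k], rather than exactly [k], makes this monotone in [k], as active edges are in
    time. *)
Definition walk G k x y := exists p,
  [/\ path (adjacency G) x p, last x p = y & size p <= k].

Lemma walk_cat G j k x y z :
  walk G j x y -> walk G k y z -> walk G (j + k) x z.
Proof.
move=> [p [hp <- sp]] [q [hq lq sq]]; exists (p ++ q); split.
- by rewrite cat_path hp.
- by rewrite last_cat.
- by rewrite size_cat leq_add.
Qed.

(** Cut after [j] steps; a shorter walk is used up by the first part and leaves the second one
    empty. *)
Lemma walk_split G j k x z :
  walk G (j + k) x z -> exists2 y, walk G j x y & walk G k y z.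
Proof.
move=> [p [hp lp sp]]; rewrite -(cat_take_drop j p) cat_path in hp.
case/andP: hp => h1 h2; exists (last x (take j p)).
  by exists (take j p); rewrite size_take; split=> //; case: ltnP.
exists (drop j p); split=> //; last by rewrite size_drop leq_subLR.
by rewrite -last_cat cat_take_drop.
Qed.

(** Removing loops leaves a path with distinct vertices, hence at most n - 1 edges. *)
Lemma walk_shorten G k x y : walk G k x y -> walk G n.-1 x y.
Proof.
move=> [p [hp <- _]]; case/shortenP: hp => q hq uq _; exists q; split=> //.
have := max_card (mem (x :: q)); rewrite (card_uniqP uq) card_ord /=; lia.
Qed.

(** One step joins the ends of two-edge walks, so the reach doubles; conversely a walk of length
    2^(t+1) is cut at its midpoint. *)
Lemma perc_iter3 G t x y : x != y ->
  ([set x; y] \in perc_iter 3 t G) <-> walk G (2 ^ t) x y.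
Proof.
elim: t x y => [|t IH] x y xy; split.
- by move=> h; exists [:: y]; rewrite /= /adjacency /= xy h.
- rewrite /walk /adjacency; case=> -[|a [|b p]] [] //=; first by move=> _ E; rewrite E eqxx in xy.
  by move=> /andP[/andP[_ h] _] <-.
- rewrite perc_iterS => /(perc_step3 _ xy)[/(IH _ _ xy)[p [h1 h2 h3]]|].
    exists p; split=> //; apply: leq_trans h3 _; exact: leq_pexp2l.
  move=> [z [zx zy]]; rewrite IH 1?eq_sym // IH // => w1 w2.
  by rewrite expnS mul2n -addnn; apply: walk_cat w1 w2.
- rewrite expnS mul2n -addnn => /walk_split[z w1 w2].
  rewrite perc_iterS; apply/perc_step3=> //.
  (* The midpoint may be an end of the walk; then one half alone already joins [x] to [y]. *)
  have [E|zx] := eqVneq z x; first by left; apply/IH=> //; rewrite -E.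
  have [E|zy] := eqVneq z y; first by left; apply/IH=> //; rewrite -E.
  by right; exists z; split=> //; apply/IH; rewrite // eq_sym.
Qed.

Lemma perc_iter3_log G :
  1 < n -> is_graph G -> perc_iter 3 (up_log 2 n.-1) G = perc_closure 3 G.
Proof.
move=> n1 gG; apply: perc_closure_eq; apply/subsetP=> e /perc_closureP[t et].
have /is_graphP/(_ e et) := perc_iter_graph 3 t gG.
move=> /is_edgeP[x [y [xy E]]]; move: et; rewrite E !perc_iter3 //.
move=> /walk_shorten [p [h1 h2 h3]]; exists p; split=> //.
exact: leq_trans h3 (up_logP _ _).
Qed.

(** * The path, extremal for triangles *)

Definition path_graph : {set {set 'I_n}} :=
  graph_of [rel x y : 'I_n | (x.+1 == y :> nat) || (y.+1 == x :> nat)].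

Lemma path_graph_adj x y :
  adjacency path_graph x y = (x.+1 == y :> nat) || (y.+1 == x :> nat).
Proof.
rewrite /adjacency /= graph_ofP; last by move=> u v /=; rewrite orbC.
by rewrite andbA andbb /=; case: eqVneq => // ->; lia.
Qed.

Lemma path_graph_walk_le k x y : walk path_graph k x y -> y <= x + k.
Proof.
move=> [p [hp <- sp]]; elim: p k x hp sp => [|z p IH] k x /=; first by lia.
rewrite path_graph_adj => /andP[xz hp] sp.
by have := IH k.-1 z hp; lia.
Qed.

Lemma path_graph_walk k x y : y = x + k :> nat -> walk path_graph k x y.
Proof.
elim: k x => [|k IH] x E.
  by exists [::]; split=> //=; apply: val_inj => /=; lia.
have lt : x.+1 < n by have := ltn_ord y; lia.
have [p [h1 h2 h3]] : walk path_graph k (Ordinal lt) y by apply: IH => /=; lia.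
by exists (Ordinal lt :: p); split=> //=; rewrite path_graph_adj /= eqxx.
Qed.

End Triangle.

Lemma tau_max_3 n : 2 <= n -> is_tau_max n 3 (ceil_log2 n.-1).
Proof.
move=> n2; rewrite /ceil_log2; split; last first.
  move=> G t gG ht; rewrite leqNgt; apply/negP=> lt.
  by case: ht => _ /(_ _ lt); apply; apply: perc_iter3_log.
exists (path_graph n); split; first exact: graph_of_graph.
have gP : is_graph (path_graph n) by apply: graph_of_graph.
split; first exact: perc_iter3_log.
have h0 : 0 < n by lia.
have h1 : n.-1 < n by lia.
have ne : Ordinal h0 != Ordinal h1 by rewrite -val_eqE /=; lia.
(* The pair of ends of the path is active at time s only if 2^s >= n - 1. *)
move=> s st E.
have : [set Ordinal h0; Ordinal h1] \in perc_iter 3 s (path_graph n).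
  rewrite E -perc_iter3_log //; apply/perc_iter3=> //.
  have [p [p1 p2 p3]] : walk (path_graph n) n.-1 (Ordinal h0) (Ordinal h1).
    exact: path_graph_walk.
  by exists p; split=> //; exact: leq_trans p3 (up_logP _ _).
move/(perc_iter3 _ _ ne)/path_graph_walk_le; rewrite /= add0n.
by move/(up_log_min (isT : 1 < 2)); lia.
Qed.

(** * K_4 *)

Section FourClique.

Variable n : nat.
Implicit Types (G : {set {set 'I_n}}) (x y z u v c d : 'I_n).
Implicit Types (C S e f g : {set 'I_n}).

Lemma perc_step4 G x y c d :
  x != y -> c != d -> c != x -> c != y -> d != x -> d != y ->
  [set x; c] \in G -> [set x; d] \in G -> [set y; c] \in G ->
  [set y; d] \in G -> [set c; d] \in G -> [set x; y] \in perc_step 4 G.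
Proof.
move=> xy cd cx cy dx dy xc xd yc yd cdG; apply/perc_stepP; right.
split; first by rewrite is_edge2.
exists (c |: (d |: [set x; y])).
  split; last by rewrite setUA subsetUr.
  by rewrite !cardsU1 cards1 !inE xy (negbTE cd) (negbTE cx) (negbTE cy)
     (negbTE dx) (negbTE dy).
move=> f /is_edgeP[u [v [uv ->]]] /subsetP hs ne.
have := hs u (set21 _ _); have := hs v (set22 _ _).
rewrite !inE => /or4P[]/eqP Ev /or4P[]/eqP Eu; move: uv ne;
  rewrite Eu Ev ?eqxx // => _; rewrite ?(set2C y x) ?eqxx // => _;
  by rewrite // set2C.
Qed.

Definition clique G C :=
  forall x y, x \in C -> y \in C -> x != y -> [set x; y] \in G.

(** The condition under which [z] joins the clique [C] within one step. *)
Definition attached G C z := z \in C \/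
  exists c d, [/\ c \in C, d \in C, c != d, [set z; c] \in G & [set z; d] \in G].

(** If [z] is joined to [c] and [d] in [C], the K_4 on z, w, c, d lacks at most the edge zw. *)
Lemma attached_step G C z w : clique G C -> attached G C z -> w \in C ->
  z != w -> [set z; w] \in perc_step 4 G.
Proof.
move=> hC hz wC zw; have sub := subsetP (perc_step_sub 4 G).
case: (boolP (z \in C)) => zC; first by apply/sub/hC.
case: hz => [|[c [d [cC dC cd zc zd]]]]; first by rewrite (negbTE zC).
have [<-|cw] := eqVneq c w; first exact: sub.
have [<-|dw] := eqVneq d w; first exact: sub.
have ne a : a \in C -> a != z by move=> aC; apply: contraNneq zC => <-.
by apply: (@perc_step4 _ _ _ c d); rewrite ?ne //; apply: hC; rewrite // eq_sym.
Qed.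

Lemma clique_attached G C z : clique G C -> attached G C z ->
  clique (perc_step 4 G) (z |: C).
Proof.
move=> hC hz x y; have sub := subsetP (perc_step_sub 4 G).
have st := attached_step hC hz.
case/setU1P=> [->|xC] /setU1P[->|yC] xy; rewrite ?eqxx // in xy *.
- exact: st.
- by rewrite set2C; apply: st => //; rewrite eq_sym.
- by apply/sub/hC.
Qed.

(** The shared vertices [u] and [v] supply the two edges into [C]. *)
Lemma K4_attached G C S u v : u \in C -> v \in C -> u != v ->
  u \in S -> v \in S -> clique G S -> forall z, z \in S -> attached G C z.
Proof.
move=> uC vC uv uS vS hS z zS; case: (boolP (z \in C)) => zC; first by left.
right; exists u, v; split=> //; apply: hS => //.
  by apply: contraNneq zC => ->.
by apply: contraNneq zC => ->.
Qed.

(* The clique of the previous step always gains a vertex: either an end of [f]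
   is new to it, or [S] contains a new vertex attached through two edges other
   than [g]. *)
Lemma clique_growth G C S g f :
  is_edge f -> f \in G -> f \subset S -> f != g ->
  clique G C -> (forall z, z \in f -> attached G C z) ->
  is_edge g -> g \notin G -> g \subset S -> #|S| = 4 ->
  (forall h, is_edge h -> h \subset S -> h != g -> h \in G) ->
  exists C', [/\ #|C| < #|C'|, clique (perc_step 4 G) C' &
                 forall z, z \in g -> attached (perc_step 4 G) C' z].
Proof.
move=> /is_edgeP[u [v [uv ->]]] fG fS fg hC hf eg gG gS cS hS.
have sub := subsetP (perc_step_sub 4 G).
have uS : u \in S by apply: (subsetP fS); rewrite set21.
have vS : v \in S by apply: (subsetP fS); rewrite set22.
have SE x y : x \in S -> y \in S -> x != y -> [set x; y] != g ->
    [set x; y] \in G.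
  move=> xS yS xy ne; apply: hS; rewrite ?is_edge2 //.
  by apply/subsetP=> w /set2P[] ->.
have hSc : clique (perc_step 4 G) S.
  move=> x y xS yS xy; case: (eqVneq [set x; y] g) => [->|ne].
    by apply/perc_stepP; right; split=> //; exists S.
  exact/sub/SE.
(* After the step [S] is a clique, so by [K4_attached] a larger clique containing both ends of [f]
   suffices. *)
suff [C' [h1 h2 h3 h4]] : exists C', [/\ #|C| < #|C'|,
    clique (perc_step 4 G) C', u \in C' & v \in C'].
  exists C'; split=> // z zg.
  exact: (K4_attached h3 h4 uv uS vS hSc (subsetP gS z zg)).
case: (boolP ((u \in C) && (v \in C))) => [/andP[uC vC]|nC].
  suff [p [pS pC hp]] : exists p, [/\ p \in S, p \notin C & attached G C p].
    exists (p |: C); rewrite !inE uC vC !orbT cardsU1 pC; split=> //.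
    exact: clique_attached.
  (* [g] is inactive and [C] is a clique, so some end [y] of [g] lies outside [C]. *)
  have [y [b [yb Eg yC]]] : exists y b, [/\ y != b, g = [set y; b] & y \notin C].
    case/is_edgeP: (eg) => y [b [yb Eg]].
    case: (boolP (y \in C)) => yC; last by exists y, b.
    exists b, y; rewrite eq_sym set2C; split=> //; apply: contraNN gG => bC.
    by rewrite Eg; apply: hC.
  have yS : y \in S by apply: (subsetP gS); rewrite Eg set21.
  have bS : b \in S by apply: (subsetP gS); rewrite Eg set22.
  (* Every edge of [S] at [c] or [d] is active. If one of them is outside [C], it is attached
     through [u] and [v]; if both are in [C], then [y] is attached through them. *)
  have /cards2P[c [d [cd Ecd]]] : #|S :\: g| == 2.
    by rewrite cardsD (setIidPr gS) cS (eqP eg).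
  have : c \in S :\: g by rewrite Ecd set21.
  have : d \in S :\: g by rewrite Ecd set22.
  rewrite !inE Eg !in_set2 !negb_or => /andP[/andP[dy db] dS] /andP[/andP[cy cb] cS'].
  have ne s a : s != y -> s != b -> [set a; s] != g.
    move=> sy sb; apply/eqP=> E; have : s \in g by rewrite -E set22.
    by rewrite Eg !inE (negbTE sy) (negbTE sb).
  have attach p : p \in S -> p \notin C -> p != y -> p != b -> attached G C p.
    move=> pS pC py pb; right; exists u, v; split=> //; rewrite set2C.
      by apply: SE; rewrite ?ne //; apply: contraNneq pC => <-.
    by apply: SE; rewrite ?ne //; apply: contraNneq pC => <-.
  case: (boolP (c \in C)) => cC; last by exists c; split=> //; apply: attach.
  case: (boolP (d \in C)) => dC; last by exists d; split=> //; apply: attach.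
  exists y; split=> //; right; exists c, d; split=> //.
    by apply: SE; rewrite ?ne // eq_sym.
  by apply: SE; rewrite ?ne // eq_sym.
(* Now an end of [f] is outside [C]; both ends are attached and [f] is active, so both are added at
   once. *)
have fu := hf u (set21 _ _); have fv := hf v (set22 _ _).
exists (u |: (v |: C)); split; rewrite ?inE ?eqxx ?orbT //.
  rewrite !cardsU1 !inE (negbTE uv).
  by move: nC; case: (u \in C); case: (v \in C).
move=> x y /setU1P[->|/setU1P[->|xC]] /setU1P[->|/setU1P[->|yC]] xy;
  rewrite ?eqxx // in xy *; first [exact: sub | by rewrite set2C; apply: sub
  | exact: attached_step hC _ _ xy | exact/sub/hC
  | by rewrite set2C; apply: attached_step hC _ _ _; rewrite // eq_sym].
Qed.

(** Induction on [t]: the K_4 completed by [e] contains another edge that is new one step earlier,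
    and the clique belonging to that edge grows by [clique_growth]. *)
Lemma late_edge_clique G t e : is_graph G ->
  e \in perc_iter 4 t.+1 G -> e \notin perc_iter 4 t G ->
  exists C, [/\ t + 4 <= #|C|, clique (perc_iter 4 t.+1 G) C &
                forall z, z \in e -> attached (perc_iter 4 t.+1 G) C z].
Proof.
move=> gG; elim: t e => [|t IH] e.
  move=> e1 e0; move: (e1); rewrite perc_iterS.
  case/perc_stepP=> [|[_ [S [cS eS] hS]]]; first by rewrite (negbTE e0).
  exists S; split; rewrite ?cS //; last by move=> z /(subsetP eS); left.
  move=> x y xS yS xy; case: (eqVneq [set x; y] e) => [->|ne] //.
  apply: (subsetP (perc_step_sub 4 _)); apply: hS; rewrite ?is_edge2 //.
  by apply/subsetP=> w /set2P[] ->.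
move=> e1 e0; have ege : is_edge e.
  by have /is_graphP/(_ e e1) := perc_iter_graph 4 t.+2 gG.
move: (e1); rewrite perc_iterS.
case/perc_stepP=> [|[_ [S [cS eS] hS]]]; first by rewrite (negbTE e0).
(* Had all other edges of [S] been active one step earlier, [e] would have appeared one step earlier
   too. *)
have [f [ef fS fe ft]] : exists f, [/\ is_edge f, f \subset S, f != e &
    f \notin perc_iter 4 t G].
  apply: contrapT => nf; case/negP: e0; rewrite perc_iterS.
  apply/perc_stepP; right; split=> //; exists S => // f h1 h2 h3.
  by apply: contrapT => /negP h4; apply: nf; exists f.
have ft1 := hS f ef fS fe.
have [C [cC hC aC]] := IH f ft1 ft.
have [C' [cC' hC' aC']] := clique_growth ef ft1 fS fe hC aC ege e0 eS cS hS.
by exists C'; split=> //; apply: leq_trans cC'; rewrite addSn ltnS.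
Qed.

Lemma sat_time4_le G t : 3 <= n -> is_graph G -> is_sat_time 4 G t -> t <= n - 3.
Proof.
case: t => [//|t] n3 gG ht; have := sat_time_strict ht (ltnSn t).
rewrite eqEsubset (perc_iter_mono _ _ (leqnSn t)) andbT => /subsetPn[e e1 e0].
have [C [cC _ _]] := late_edge_clique gG e1 e0.
by have := subset_leq_card (subsetT C); rewrite cardsT card_ord; lia.
Qed.

(** * The ladder, extremal for K_4 *)

Definition ladder_lt t (x y : nat) :=
  (x < y) && [|| y == x.+1, x == y %% 2 | y < t + 3].

(** The state after [t] steps: a clique on 0, ..., t + 2, and above it only the edges to the
    predecessor and to the parity. *)
Definition ladder t : {set {set 'I_n}} :=
  graph_of [rel x y : 'I_n | ladder_lt t x y || ladder_lt t y x].

Lemma ladderP t x y : ([set x; y] \in ladder t) = ladder_lt t x y || ladder_lt t y x.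
Proof.
rewrite graph_ofP /=; last by move=> u v /=; rewrite orbC.
by case: eqVneq => // ->; rewrite /ladder_lt; lia.
Qed.

Lemma is_edge_ltP e : is_edge e -> exists x y : 'I_n, x < y /\ e = [set x; y].
Proof.
move=> /is_edgeP[x [y [xy ->]]]; have : (x : nat) != y by [].
rewrite neq_ltn => /orP[lt|lt]; first by exists x, y.
by exists y, x; rewrite set2C.
Qed.

Lemma ladder_low t (u v : nat) : t + 3 <= v -> ladder_lt t u v -> v = u.+1 \/ u = v %% 2.
Proof.
move=> tv /andP[_ /or3P[/eqP|/eqP|]]; [by left|by right|by rewrite ltnNge tv].
Qed.

Lemma ladder_lt_or t (u v : nat) : u < v -> ladder_lt t u v || ladder_lt t v u = ladder_lt t u v.
Proof. by move=> uv; rewrite /ladder_lt (ltnNge v u) (ltnW uv) orbF. Qed.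

(** Here xy is the pair to be added and c, d complete the K_4. Suppose y >= t + 4. If d > y, then d
    has three lower neighbours, but [ladder_low] allows two. Otherwise d = y - 1 and c is the parity
    of y, while c must also be d - 1 or the parity of d. *)
Lemma ladder_lt_step t (x y c d : nat) :
  x < y -> c < d -> c != x -> c != y -> d != x -> d != y ->
  ladder_lt t x c || ladder_lt t c x -> ladder_lt t x d || ladder_lt t d x ->
  ladder_lt t y c || ladder_lt t c y -> ladder_lt t y d || ladder_lt t d y ->
  ladder_lt t c d || ladder_lt t d c -> ladder_lt t.+1 x y.
Proof.
move=> xy cd cx cy dx dy _ xd yc yd; rewrite (ladder_lt_or _ cd) => hcd.
rewrite /ladder_lt xy /=; apply/or3P.
have [|yt] := ltnP y (t.+1 + 3); first by move=> *; apply: Or33.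
have [dy'|yd'] := ltnP d y; last first.
  have {}yd' : y < d by rewrite ltn_neqAle eq_sym dy.
  have td : t + 3 <= d by apply: leq_trans (ltnW yd'); apply: leq_trans yt; rewrite leq_add2r.
  rewrite ladder_lt_or ?(ltn_trans xy) // in xd.
  rewrite ladder_lt_or // in yd.
  have := ladder_low td xd; have := ladder_low td yd; have := ladder_low td hcd.
  move: (d %% 2) => m; clear - xy cd cx cy yd'; lia.
have ty : t + 3 <= y by apply: leq_trans yt; rewrite leq_add2r.
rewrite orbC ladder_lt_or ?(ltn_trans cd) // in yc.
rewrite orbC ladder_lt_or // in yd.
have y2 : y %% 2 < 2 by rewrite ltn_pmod.
have y_d : y = d.+1 /\ c = y %% 2.
  have := ladder_low ty yc; have := ladder_low ty yd.
  move: (y %% 2) y2 => m; clear - cd dy' yt; lia.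
case: y_d => y_d c_y; have td : t + 3 <= d by clear - yt y_d; lia.
have [dc|cd2] := ladder_low td hcd; first by clear - yt y_d c_y y2 dc; lia.
by move: c_y; rewrite y_d cd2 !modn2 /=; case: (odd d).
Qed.

Lemma ladder_step t : perc_step 4 (ladder t) = ladder t.+1.
Proof.
have mono : forall e, e \in ladder t -> e \in ladder t.+1.
  move=> e et; have /is_graphP/(_ e et)/is_edgeP[x [y [xy E]]] : is_graph (ladder t).
    exact: graph_of_graph.
  by move: et; rewrite E !ladderP /ladder_lt; lia.
apply/setP=> e; apply/idP/idP.
  case/perc_stepP=> [/mono //|[/is_edge_ltP[x [y [xy Ee]]] [S [cS eS] hS]]].
  have /is_edge_ltP[c [d [cd Ecd]]] : is_edge (S :\: e).
    by rewrite /is_edge cardsD (setIidPr eS) cS Ee cards2 -val_eqE (ltn_eqF xy).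
  have := set21 c d; rewrite -Ecd in_setD => /andP[ce cS'].
  have := set22 c d; rewrite -Ecd in_setD => /andP[de dS].
  move: ce de; rewrite Ee !in_set2 !negb_or -!val_eqE /=.
  move=> /andP[cx cy] /andP[dx dy].
  have xS : x \in S by apply: (subsetP eS); rewrite Ee set21.
  have yS : y \in S by apply: (subsetP eS); rewrite Ee set22.
  have L (a b : 'I_n) : a \in S -> b \in S -> (a : nat) != b ->
      (b : nat) != x -> (b : nat) != y -> ladder_lt t a b || ladder_lt t b a.
    move=> aS bS ab bx by'; rewrite -ladderP; apply: hS.
    - by rewrite is_edge2.
    - by apply/subsetP=> w /set2P[] ->.
    - apply/eqP=> E; have : b \in e by rewrite -E set22.
      by rewrite Ee !inE -!val_eqE /= (negbTE bx) (negbTE by').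
  rewrite ladderP (@ladder_lt_step t x y c d) //; try (apply: L => //; lia).
move=> e1; have /is_graphP/(_ e e1)/is_edge_ltP[x [y [xy E]]] : is_graph (ladder t.+1).
  exact: graph_of_graph.
have [h|h] := boolP (ladder_lt t x y).
  by apply: (subsetP (perc_step_sub _ _)); rewrite E ladderP h.
have [hy hx1 hx2] : [/\ (y : nat) = t + 3, y != x.+1 :> nat & x != y %% 2 :> nat].
  by move: e1 h; rewrite E ladderP /ladder_lt; split; lia.
have yn := ltn_ord y.
(* The new edge joins y = t + 3 to a vertex x of the clique; the K_4 is completed by the two lower
   neighbours of y, namely t + 2 and its parity. *)
have hc : t + 2 < n by lia.
have hd : y %% 2 < n by lia.
rewrite E; apply: (@perc_step4 _ _ _ (Ordinal hc) (Ordinal hd));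
  rewrite -?val_eqE /= ?ladderP /ladder_lt /=; lia.
Qed.

Lemma ladder_iter t : perc_iter 4 t (ladder 0) = ladder t.
Proof. by elim: t => [//|t IH]; rewrite perc_iterS IH ladder_step. Qed.

End FourClique.

Lemma tau_max_4 n : 3 <= n -> is_tau_max n 4 (n - 3).
Proof.
move=> n3; split; last by move=> G t; exact: sat_time4_le.
exists (ladder n 0); split; first exact: graph_of_graph.
have full : perc_iter 4 (n - 3) (ladder n 0) = perc_closure 4 (ladder n 0).
  apply: perc_iter_stable; rewrite ladder_iter ladder_step.
  apply/setP=> e; have [/is_edgeP[x [y [xy ->]]]|ne] := boolP (is_edge e).
    rewrite !ladderP /ladder_lt; have := ltn_ord x; have := ltn_ord y; lia.
  have nin t : e \notin ladder n t.
    by apply: contraNN ne; apply/is_graphP: e; apply: graph_of_graph.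
  by rewrite (negbTE (nin _)) (negbTE (nin _)).
split=> // s st; rewrite -full !ladder_iter => E.
(* The vertex among 0, 1 whose parity is opposite to s + 3 is not yet adjacent to s + 3 at time
   s. *)
have hy : s + 3 < n by lia.
have hx : (s + 4) %% 2 < n by lia.
have : [set Ordinal hx; Ordinal hy] \in ladder n (n - 3).
  by rewrite ladderP /ladder_lt /=; lia.
by rewrite -E ladderP /ladder_lt /=; lia.
Qed.

(** * Chains of cliques *)

Section Chain.

Variables (r n T : nat) (F : {set {set 'I_n}}).
Variables (H ed : nat -> {set 'I_n}).

Hypothesis F_graph : is_graph F.
Hypothesis H_card : forall k, 1 <= k <= T -> #|H k| = r.
Hypothesis H_sub : forall k f, 1 <= k <= T -> is_edge f -> f \subset H k -> f \in F.
Hypothesis ed_edge : forall j, j <= T -> is_edge (ed j).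
Hypothesis ed_H : forall j k, j <= T -> 1 <= k <= T ->
  (ed j \subset H k) = (j == k) || (j.+1 == k).
Hypothesis near_clique : forall S e : {set 'I_n}, #|S| = r -> is_edge e -> e \subset S ->
  (forall f : {set 'I_n}, is_edge f -> f \subset S -> f != e -> f \in F) ->
  exists2 k, 1 <= k <= T & S = H k.

(** The expected state at time [t]. Among the cliques [H k], only [H t.+1] lacks exactly one edge:
    earlier ones are complete and later ones lack two. *)
Definition stage t : {set {set 'I_n}} :=
  [set f in F | ~~ [exists j : 'I_T.+1, (t < j) && (f == ed j)]].

Lemma stageP t f :
  reflect (f \in F /\ forall j, t < j <= T -> f <> ed j) (f \in stage t).
Proof.
rewrite inE; apply: (iffP andP) => -[fF hf]; split=> //.
  move=> j /andP[tj jT] E; case/existsP: hf.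
  by exists (Ordinal (jT : j < T.+1)); rewrite /= tj E eqxx.
apply/existsP=> -[j /andP[tj /eqP E]]; apply: (hf j) => //.
by rewrite tj -ltnS ltn_ord.
Qed.

(** [ed i] lies in [H i], so j is i or i - 1; symmetrically i is j or j - 1. *)
Lemma ed_inj i j : 1 <= i <= T -> 1 <= j <= T -> ed i = ed j -> i = j.
Proof.
move=> hi hj E.
have /esym := ed_H (proj2 (andP hi)) hj; rewrite E ed_H ?eqxx; try lia.
have /esym := ed_H (proj2 (andP hj)) hi; rewrite -E ed_H ?eqxx; lia.
Qed.

Lemma stage_step t : t < T -> perc_step r (stage t) = stage t.+1.
Proof.
move=> tT; apply/setP=> e; apply/perc_stepP/stageP.
  case=> [/stageP[eF he]|[ee [S [cS eS] hS]]].
    by split=> // j hj; apply: he; lia.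
  have [k hk ES] : exists2 k, 1 <= k <= T & S = H k.
    apply: near_clique cS ee eS _ => f h1 h2 h3.
    by case/stageP: (hS f h1 h2 h3).
  split; first by apply: (H_sub hk ee); rewrite -ES.
  move=> j hj E; have jT : j <= T by lia.
  move: (eS); rewrite E ES ed_H // => hjk.
  (* If [ed j] with j > t + 1 were added, [H k] would also contain the missing edge of index j - 1
     or j + 1. *)
  have [i [hi ik ij]] : exists i, [/\ t < i <= T, (i == k) || (i.+1 == k) & i != j].
    case/orP: hjk => /eqP hjk; [exists j.-1|exists j.+1]; split; lia.
  have iT : i <= T by lia.
  have : ed i \in stage t.
    apply: hS; first exact: ed_edge.
      by rewrite ES ed_H.
    apply/eqP; rewrite E => /ed_inj; lia.
  by case/stageP=> _ /(_ i hi).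
move=> [eF he]; have [E|ne] := eqVneq e (ed t.+1); last first.
  left; apply/stageP; split=> // j hj; have [->|nj] := eqVneq j t.+1.
    exact/eqP.
  by apply: he; lia.
have hk : 1 <= t.+1 <= T by lia.
right; rewrite E ed_edge //; split=> //; exists (H t.+1).
  by rewrite H_card // ed_H ?eqxx //; lia.
move=> f ef fH fe; apply/stageP; split; first exact: H_sub fH.
move=> j hj Ef; move: fH; rewrite Ef ed_H; try lia.
move=> /orP[/eqP jt|]; last by lia.
by move/eqP: fe; apply; rewrite Ef jt.
Qed.

Lemma stage_iter t : t <= T -> perc_iter r t (stage 0) = stage t.
Proof.
by elim: t => [//|t IH] tT; rewrite perc_iterS IH ?stage_step // ltnW.
Qed.

Lemma chain_sat_time : exists (G : {set {set 'I_n}}) t, [/\ is_graph G, is_sat_time r G t & T <= t].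
Proof.
exists (stage 0); have [t ht] := sat_time_exists r (stage 0).
exists t; split=> //.
  by apply/is_graphP=> f /stageP[fF _]; move/is_graphP: F_graph; apply.
apply: (sat_time_ge _ ht) => s sT; rewrite !stage_iter //; last exact: ltnW.
have hk : 1 <= s.+1 <= T by lia.
have edF : ed s.+1 \in F by apply: (H_sub hk); rewrite ?ed_edge ?ed_H ?eqxx.
move=> E; have : ed s.+1 \in stage s.+1.
  by apply/stageP; split=> // j hj /ed_inj; lia.
by rewrite E => /stageP[_ /(_ s.+1)]; apply; rewrite // ltnSn.
Qed.

End Chain.

(** * The cyclic strip *)

Inductive color := Red | Green | Apex.

Section Construction.

Variables (rho B : nat).

(** For |b|, |c| <= 2B, the number 4b + (8B + 4)c is at most 16B^2 + 16B in absolute value, four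
    less than this. *)
Definition base := 16 * B ^ 2 + 16 * B + 4.

Definition modulus c :=
  match c with Red => base | Green => base + 4 | Apex => base + (8 * B + 4) end.

(** The numbers below [rho] are kept for universal vertices; the colours occupy consecutive
    intervals after them. *)
Definition offset c :=
  match c with
  | Red => rho
  | Green => rho + modulus Red
  | Apex => rho + modulus Red + modulus Green
  end.

Definition vertex c t := offset c + t %% modulus c.

(** Labels up to this bound wind around each of the three cycles at most [B] times. *)
Definition horizon := B * base.

Definition vertex_count := rho + modulus Red + modulus Green + modulus Apex.

Lemma modulus_gt0 c : 0 < modulus c.
Proof. by case: c => /=; rewrite /base; lia. Qed.

Lemma vertex_bounds c t : offset c <= vertex c t < offset c + modulus c.
Proof. by rewrite /vertex leq_addr ltn_add2l ltn_pmod // modulus_gt0. Qed.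

Lemma vertex_ge c t : rho <= vertex c t.
Proof. by have := vertex_bounds c t; case: c => /=; lia. Qed.

Lemma vertex_lt c t : vertex c t < vertex_count.
Proof. by have := vertex_bounds c t; rewrite /vertex_count; case: c => /=; lia. Qed.

Lemma vertex_inj c d t s :
  vertex c t = vertex d s -> c = d /\ t = s %[mod modulus c].
Proof.
have := vertex_bounds c t; have := vertex_bounds d s.
case: c; case: d => hs ht E; try (by exfalso; move: hs ht E => /=; lia);
  by split=> //; apply: addnI E.
Qed.

(** With m = [base] the combination is (a + b + c)m + 4b + (8B + 4)c. The size of m forces a + b + c
    = 0; then |4b| <= 8B forces c = 0, and finally b = 0. *)
Lemma modulus_independent (a b c : Z) :
  (- (2 * Z.of_nat B) <= a <= 2 * Z.of_nat B)%Z ->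
  (- (2 * Z.of_nat B) <= b <= 2 * Z.of_nat B)%Z ->
  (- (2 * Z.of_nat B) <= c <= 2 * Z.of_nat B)%Z ->
  (- 3 <= a * Z.of_nat (modulus Red) + b * Z.of_nat (modulus Green)
          + c * Z.of_nat (modulus Apex) <= 3)%Z ->
  a = 0%Z /\ b = 0%Z /\ c = 0%Z.
Proof.
rewrite /modulus /base.
have -> : Z.of_nat (16 * B ^ 2 + 16 * B + 4) =
  (16 * Z.of_nat B * Z.of_nat B + 16 * Z.of_nat B + 4)%Z by lia.
have -> : Z.of_nat (16 * B ^ 2 + 16 * B + 4 + 4) =
  (16 * Z.of_nat B * Z.of_nat B + 16 * Z.of_nat B + 8)%Z by lia.
have -> : Z.of_nat (16 * B ^ 2 + 16 * B + 4 + (8 * B + 4)) =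
  (16 * Z.of_nat B * Z.of_nat B + 24 * Z.of_nat B + 8)%Z by lia.
move: (Z.of_nat B) (Zle_0_nat B) => N N0 ha hb hc h.
(* These products bound [N * c], which linear arithmetic treats as an independent unknown. *)
have c1 : (0 <= N * (2 * N - c))%Z by apply: Z.mul_nonneg_nonneg; lia.
have c2 : (0 <= N * (2 * N + c))%Z by apply: Z.mul_nonneg_nonneg; lia.
have NN : (0 <= N * N)%Z by apply: Z.mul_nonneg_nonneg.
set K := (16 * N * N + 16 * N + 4)%Z.
have K0 : (0 <= K)%Z by rewrite /K; lia.
have hK : (- 3 <= (a + b + c) * K + 4 * b + 8 * (N * c) + 4 * c <= 3)%Z.
  by rewrite /K; lia.
have s0 : (a + b + c = 0)%Z.
  have [//|[s1|s1]] : (a + b + c = 0 \/ 1 <= a + b + c \/ a + b + c <= -1)%Z by lia.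
    have := Z.mul_le_mono_nonneg_r _ _ K K0 s1; rewrite {1}/K; lia.
  have := Z.mul_le_mono_nonneg_r _ _ K K0 s1; rewrite {2}/K; lia.
rewrite s0 in hK.
have c0 : (c = 0)%Z.
  have [//|[s1|s1]] : (c = 0 \/ 1 <= c \/ c <= -1)%Z by lia.
    have := Z.mul_le_mono_nonneg_l _ _ N N0 s1; lia.
  have := Z.mul_le_mono_nonneg_l _ _ N N0 s1; lia.
by subst c; lia.
Qed.

(** * Congruent labels and winding numbers *)

Definition zmod c := Z.of_nat (modulus c).

Lemma cong_multiple c t s : t <= horizon -> s <= horizon ->
  t = s %[mod modulus c] -> exists a : Z,
    (Z.of_nat t - Z.of_nat s = a * zmod c)%Z /\
    (- Z.of_nat B <= a <= Z.of_nat B)%Z.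
Proof.
have m0 := modulus_gt0 c.
have mh : horizon <= B * modulus c.
  by rewrite /horizon leq_mul2l; case: c m0 => /= _; lia.
move=> ht hs E.
have quot_le u : u <= horizon -> u %/ modulus c <= B.
  move=> hu; rewrite -(leq_pmul2r m0).
  exact: leq_trans (leq_trunc_div u _) (leq_trans hu mh).
exists (Z.of_nat (t %/ modulus c) - Z.of_nat (s %/ modulus c))%Z.
rewrite {1}(divn_eq t (modulus c)) {1}(divn_eq s (modulus c)) E /zmod.
move: (quot_le t ht) (quot_le s hs).
move: (t %/ _) (s %/ _) (s %% _) => u v w.
by move: (modulus c) => k *; lia.
Qed.

(** The relation between labels that occur in a common block. *)
Definition near (t s : nat) := (t <= s.+1) && (s <= t.+1).

Lemma cong_pair c d t1 s1 t2 s2 : c <> d ->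
  t1 <= horizon -> s1 <= horizon -> t2 <= horizon -> s2 <= horizon ->
  t1 = s1 %[mod modulus c] -> t2 = s2 %[mod modulus d] ->
  near t1 t2 -> near s1 s2 -> t1 = s1 /\ t2 = s2.
Proof.
move=> cd h1 h2 h3 h4 /cong_multiple[] // a [E1 ha] /cong_multiple[] // b [E2 hb].
rewrite /near => n1 n2.
suff [a0 b0] : a = 0%Z /\ b = 0%Z by subst; lia.
rewrite /zmod in E1 E2.
case: c d cd E1 E2 => -[] // _ E1 E2;
  [ have := @modulus_independent a (-b)%Z 0%Z
  | have := @modulus_independent a 0%Z (-b)%Z
  | have := @modulus_independent (-b)%Z a 0%Z
  | have := @modulus_independent 0%Z a (-b)%Z
  | have := @modulus_independent (-b)%Z 0%Z a
  | have := @modulus_independent 0%Z (-b)%Z a ]; lia.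
Qed.

(** Around the triangle the windings add up to three differences of size at most 1; hence the
    tolerance 3 in [modulus_independent]. *)
Lemma cong_triangle t1 s1 t2 s2 t3 s3 :
  t1 <= horizon -> s1 <= horizon -> t2 <= horizon -> s2 <= horizon ->
  t3 <= horizon -> s3 <= horizon ->
  t1 = s1 %[mod modulus Red] -> t2 = s2 %[mod modulus Green] ->
  t3 = s3 %[mod modulus Apex] ->
  near t1 t2 -> near s2 t3 -> near s1 s3 -> t3 = s3.
Proof.
move=> h1 h2 h3 h4 h5 h6 /cong_multiple[] // a [E1 ha].
move=> /cong_multiple[] // b [E2 hb] /cong_multiple[] // c [E3 hc].
rewrite /near => n1 n2 n3.
rewrite /zmod in E1 E2 E3.
by have := @modulus_independent (- a)%Z b c; lia.
Qed.

(** The two vertices of colour [c] contribute a difference of two winding numbers; hence the range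
    2B in [modulus_independent]. *)
Lemma cong_isosceles c d a a' b b' t t' : c <> d ->
  a <= horizon -> a' <= horizon -> b <= horizon -> b' <= horizon ->
  t <= horizon -> t' <= horizon ->
  a = a' %[mod modulus c] -> b = b' %[mod modulus c] ->
  t = t' %[mod modulus d] ->
  near a b -> near a' t -> near b' t' -> t = t' /\ near a' b'.
Proof.
move=> cd h1 h2 h3 h4 h5 h6 /cong_multiple[] // x [E1 hx].
move=> /cong_multiple[] // y [E2 hy] /cong_multiple[] // z [E3 hz].
rewrite /near => n1 n2 n3.
suff [xy0 z0] : (y - x = 0)%Z /\ z = 0%Z.
  by have xy : x = y; [lia|subst; lia].
rewrite /zmod in E1 E2 E3.
case: c d cd E1 E2 E3 => -[] // _ E1 E2 E3;
  [ have := @modulus_independent (y - x)%Z (-z)%Z 0%Z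
  | have := @modulus_independent (y - x)%Z 0%Z (-z)%Z
  | have := @modulus_independent (-z)%Z (y - x)%Z 0%Z
  | have := @modulus_independent 0%Z (y - x)%Z (-z)%Z
  | have := @modulus_independent (-z)%Z 0%Z (y - x)%Z
  | have := @modulus_independent 0%Z (-z)%Z (y - x)%Z ]; lia.
Qed.

(** Three differences of +1 or -1 have an odd sum of size at most 3, which cannot be a multiple of a
    modulus that is at least 4. *)
Lemma cong_no_mono c a a' b b' d d' :
  a <= horizon -> a' <= horizon -> b <= horizon -> b' <= horizon ->
  d <= horizon -> d' <= horizon ->
  a = a' %[mod modulus c] -> b = b' %[mod modulus c] ->
  d = d' %[mod modulus c] ->
  near a b -> near b' d -> near d' a' -> a != b -> b' != d -> d' != a' -> False.
Proof.
move=> h1 h2 h3 h4 h5 h6 /cong_multiple[] // x [E1 hx].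
move=> /cong_multiple[] // y [E2 hy] /cong_multiple[] // z [E3 hz].
rewrite /near => n1 n2 n3 e1 e2 e3.
have m4 : (4 <= zmod c)%Z by rewrite /zmod; case: c {E1 E2 E3} => /=; rewrite /base; lia.
have E : ((x - y - z) * zmod c =
    (Z.of_nat a - Z.of_nat b) + (Z.of_nat b' - Z.of_nat d)
    + (Z.of_nat d' - Z.of_nat a'))%Z by lia.
have [e0|[e0|e0]] : (x - y - z = 0 \/ x - y - z >= 1 \/ x - y - z <= -1)%Z by lia.
- by rewrite e0 in E; lia.
- by nia.
- by nia.
Qed.

(** * Blocks, their labels and adjacency *)

Definition block k :=
  [:: vertex Red k.-1; vertex Red k; vertex Green k.-1; vertex Green k; vertex Apex k].

(** [t] is the label of [v] in block [k] of the unwrapped strip. *)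
Definition lifts c k t (v : nat) :=
  v = vertex c t /\ (t <= k <= t.+1) /\ (c = Apex -> t = k).

Lemma blockP k v : 1 <= k -> v \in block k <-> exists c t, lifts c k t v.
Proof.
move=> k1; rewrite !inE; split.
  case/or4P=> [/eqP->|/eqP->|/eqP->|/orP[]/eqP->].
  - by exists Red, k.-1; split=> //; split=> //; lia.
  - by exists Red, k; split=> //; split=> //; lia.
  - by exists Green, k.-1; split=> //; split=> //; lia.
  - by exists Green, k; split=> //; split=> //; lia.
  - by exists Apex, k; split=> //; split=> //; lia.
move=> [[] [t [-> [tk tR]]]].
- by have [->|->] : t = k \/ t = k.-1 by [lia]; rewrite eqxx ?orbT.
- by have [->|->] : t = k \/ t = k.-1 by [lia]; rewrite eqxx ?orbT.
- by rewrite tR // eqxx !orbT.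
Qed.

Definition coloured c v := exists t, v = vertex c t.

Lemma block_lifts c k v : 1 <= k -> coloured c v -> v \in block k ->
  exists t, lifts c k t v.
Proof.
move=> k1 [s ->] /(blockP _ k1)[d [t [E ht]]].
by have [Ec _] := vertex_inj E; subst d; exists t; split.
Qed.

Definition adj u v :=
  exists k, [/\ 1 <= k <= horizon, u \in block k & v \in block k].

Lemma adj_sym u v : adj u v -> adj v u.
Proof. by move=> [k [h1 h2 h3]]; exists k. Qed.

Lemma adj_coloured u v : adj u v -> exists c, coloured c u.
Proof.
by move=> [k [/andP[k1 _] /(blockP _ k1)[c [t [-> _]]] _]]; exists c, t.
Qed.

Lemma adj_lifts c d u v : coloured c u -> coloured d v -> adj u v ->
  exists k t s, [/\ 1 <= k <= horizon, lifts c k t u & lifts d k s v].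
Proof.
move=> cu dv [k [hk ku kv]]; have k1 : 1 <= k by case/andP: hk.
have [t ht] := block_lifts k1 cu ku; have [s hs] := block_lifts k1 dv kv.
by exists k, t, s.
Qed.

Lemma lifts_cong c k l t s v :
  lifts c k t v -> lifts c l s v -> t = s %[mod modulus c].
Proof. by move=> [-> _] [/vertex_inj[_]]. Qed.

Lemma lifts_le c k t v : lifts c k t v -> k <= horizon -> t <= horizon.
Proof. by move=> [_ [h _]]; lia. Qed.

Lemma lifts_near c d k t s u v : lifts c k t u -> lifts d k s v -> near t s.
Proof. by move=> [_ [h1 _]] [_ [h2 _]]; rewrite /near; lia. Qed.

Lemma lifts_neq c k l t s u v :
  lifts c k t u -> lifts c l s v -> u != v -> t != s.
Proof. by move=> [-> _] [-> _]; apply: contraNneq => ->. Qed.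

Lemma lifts_block c k t v : 1 <= k -> lifts c k t v -> v \in block k.
Proof. by move=> k1 h; apply/blockP=> //; exists c, t. Qed.

Lemma coloured_pair c d k l t s t' s' u v : c <> d ->
  1 <= k <= horizon -> 1 <= l <= horizon ->
  lifts c k t u -> lifts d k s v -> lifts c l t' u -> lifts d l s' v ->
  t = t' /\ s = s'.
Proof.
move=> cd hk hl h1 h2 h3 h4; have kT : k <= horizon by lia.
have lT : l <= horizon by lia.
apply: (cong_pair cd).
- exact: lifts_le h1 kT.
- exact: lifts_le h3 lT.
- exact: lifts_le h2 kT.
- exact: lifts_le h4 lT.
- exact: lifts_cong h1 h3.
- exact: lifts_cong h2 h4.
- exact: lifts_near h1 h2.
- exact: lifts_near h3 h4.
Qed.

(** The label of an Apex vertex is the index of its block, and [cong_triangle] shows that [r] has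
    the same label in both blocks. *)
Lemma apex_triangle c d k l r x y : c <> d -> c <> Apex -> d <> Apex ->
  coloured Apex r -> coloured c x -> coloured d y ->
  1 <= k <= horizon -> 1 <= l <= horizon ->
  r \in block k -> x \in block k -> r \in block l -> y \in block l ->
  adj x y -> k = l.
Proof.
wlog : c d k l x y / c = Red /\ d = Green.
  move=> W; case: c; case: d => // cd _ _ cr cx cy hk hl rk xk rl yl xy.
    exact: (W Red Green k l x y).
  by symmetry; apply: (W Red Green l k y x) => //; apply: adj_sym.
move=> [-> ->] _ _ _ cr cx cy hk hl rk xk rl yl xy.
have k1 : 1 <= k by lia.
have l1 : 1 <= l by lia.
have kT : k <= horizon by lia.
have lT : l <= horizon by lia.
have [j [a [b [hj xa yb]]]] := adj_lifts cx cy xy.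
have jT : j <= horizon by lia.
have [t rt] := block_lifts k1 cr rk; have [t' rt'] := block_lifts l1 cr rl.
have [a' xa'] := block_lifts k1 cx xk; have [b' yb'] := block_lifts l1 cy yl.
case: (rt) => _ [_ <- //]; case: (rt') => _ [_ <- //]; symmetry.
apply: (@cong_triangle a a' b b' t' t).
- exact: lifts_le xa jT.
- exact: lifts_le xa' kT.
- exact: lifts_le yb jT.
- exact: lifts_le yb' lT.
- exact: lifts_le rt' lT.
- exact: lifts_le rt kT.
- exact: lifts_cong xa xa'.
- exact: lifts_cong yb yb'.
- exact: lifts_cong rt' rt.
- exact: lifts_near xa yb.
- exact: lifts_near yb' rt'.
- exact: lifts_near xa' rt.
Qed.

(** The edge between [p] and [p'] may come from a third block; [cong_isosceles] carries its labels
    over to blocks [k] and [l]. *)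
Lemma base_triangle c d k l p p' q a a' b b' : c <> d ->
  coloured c p -> coloured c p' -> adj p p' ->
  1 <= k <= horizon -> 1 <= l <= horizon ->
  lifts c k a p -> lifts d k b q -> lifts c l a' p' -> lifts d l b' q ->
  b = b' /\ near a a'.
Proof.
move=> cd cp cp' pp hk hl pa qb pa' qb'.
have kT : k <= horizon by lia.
have lT : l <= horizon by lia.
have [j [x [x' [hj px px']]]] := adj_lifts cp cp' pp.
have jT : j <= horizon by lia.
apply: (@cong_isosceles c d x a x' a').
- by [].
- exact: lifts_le px jT.
- exact: lifts_le pa kT.
- exact: lifts_le px' jT.
- exact: lifts_le pa' lT.
- exact: lifts_le qb kT.
- exact: lifts_le qb' lT.
- exact: lifts_cong px pa.
- exact: lifts_cong px' pa'.
- exact: lifts_cong qb qb'.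
- exact: lifts_near px px'.
- exact: lifts_near pa qb.
- exact: lifts_near pa' qb'.
Qed.

Lemma no_mono_triangle c x y z :
  coloured c x -> coloured c y -> coloured c z ->
  x != y -> y != z -> z != x -> adj x y -> adj y z -> adj z x -> False.
Proof.
move=> cx cy cz xy yz zx axy ayz azx.
have [j [a [b [hj xa yb]]]] := adj_lifts cx cy axy.
have [k [b' [d [hk yb' zd]]]] := adj_lifts cy cz ayz.
have [l [d' [a' [hl zd' xa']]]] := adj_lifts cz cx azx.
have jT : j <= horizon by lia.
have kT : k <= horizon by lia.
have lT : l <= horizon by lia.
apply: (@cong_no_mono c a a' b b' d d').
- exact: lifts_le xa jT.
- exact: lifts_le xa' lT.
- exact: lifts_le yb jT.
- exact: lifts_le yb' kT.
- exact: lifts_le zd kT.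
- exact: lifts_le zd' lT.
- exact: lifts_cong xa xa'.
- exact: lifts_cong yb yb'.
- exact: lifts_cong zd zd'.
- exact: lifts_near xa yb.
- exact: lifts_near yb' zd.
- exact: lifts_near zd' xa'.
- exact: lifts_neq xa yb xy.
- exact: lifts_neq yb' zd yz.
- exact: lifts_neq zd' xa' zx.
Qed.

Lemma no_apex_pair x y : coloured Apex x -> coloured Apex y -> x != y -> adj x y -> False.
Proof.
move=> cx cy xy /(adj_lifts cx cy)[k [a [b [_ xa yb]]]].
have /negP := lifts_neq xa yb xy; apply.
by case: xa => _ [_ -> //]; case: yb => _ [_ -> //].
Qed.

(** The vertices x, y, z are not all of one colour, so two of their pairs are bichromatic and
    [apex_triangle] identifies the three blocks. *)
Lemma apex_clique c d e r x y z : c <> Apex -> d <> Apex -> e <> Apex ->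
  coloured Apex r -> coloured c x -> coloured d y -> coloured e z ->
  x != y -> y != z -> z != x ->
  adj r x -> adj r y -> adj r z -> adj x y -> adj y z -> adj z x ->
  exists k, [/\ 1 <= k <= horizon, r \in block k, x \in block k, y \in block k
              & z \in block k].
Proof.
move=> cR dR eR cr cx cy cz xy yz zx [k [hk rk xk]] [l [hl rl yl]] [j [hj rj zj]].
move=> axy ayz azx.
have kl : c <> d -> k = l.
  by move=> cd; apply: (apex_triangle cd cR dR cr cx cy hk hl rk xk rl yl).
have lj : d <> e -> l = j.
  by move=> de; apply: (apex_triangle de dR eR cr cy cz hl hj rl yl rj zj).
have jk : e <> c -> j = k.
  by move=> ec; apply: (apex_triangle ec eR cR cr cz cx hj hk rj zj rk xk).
suff [E1 E2] : k = l /\ j = l by exists l; subst.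
case: c d e cR dR eR cx cy cz kl lj jk => -[] // [] // _ _ _ cx cy cz kl lj jk;
  try (split; first [by rewrite kl | by rewrite -lj | by rewrite jk // kl
   | by rewrite -jk // -lj]);
  by case: (no_mono_triangle cx cy cz).
Qed.

(** The four triangles give every vertex one consistent label. Then a and a' are consecutive, and b
    and b', being near both, take the same two values; the block is the larger one. *)
Lemma square_clique c d p p' q q' : c <> d -> c <> Apex -> d <> Apex ->
  coloured c p -> coloured c p' -> coloured d q -> coloured d q' ->
  p != p' -> q != q' ->
  adj p p' -> adj q q' -> adj p q -> adj p q' -> adj p' q -> adj p' q' ->
  exists k, [/\ 1 <= k <= horizon, p \in block k, p' \in block k, q \in block k
              & q' \in block k].
Proof.
move=> cd cR dR cp cp' cq cq' npp nqq pp qq.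
move=> /(adj_lifts cp cq)[k1 [a [b [h1 pa qb]]]].
move=> /(adj_lifts cp cq')[k2 [a1 [b' [h2 pa1 qb']]]].
move=> /(adj_lifts cp' cq)[k3 [a' [b1 [h3 pa' qb1]]]].
move=> /(adj_lifts cp' cq')[k4 [a2 [b2 [h4 pa2 qb2]]]].
have dc : d <> c by move=> E; apply: cd.
have [Eb naa] := base_triangle cd cp cp' pp h1 h3 pa qb pa' qb1.
have [Eb' _] := base_triangle cd cp cp' pp h2 h4 pa1 qb' pa2 qb2.
have [Ea nbb] := base_triangle dc cq cq' qq h1 h2 qb pa qb' pa1.
have [Ea' _] := base_triangle dc cq cq' qq h3 h4 qb1 pa' qb2 pa2.
subst b1 b2 a1 a2.
have na := lifts_neq pa pa' npp; have nb := lifts_neq qb qb' nqq.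
have n1 := lifts_near pa qb; have n2 := lifts_near pa1 qb'.
have n3 := lifts_near pa' qb1; have n4 := lifts_near pa2 qb2.
have l1 := lifts_le pa (proj2 (andP h1)).
have l2 := lifts_le pa' (proj2 (andP h3)).
rewrite /near in naa nbb n1 n2 n3 n4.
have M1 : 1 <= maxn a a' by lia.
exists (maxn a a'); split; first by lia.
- apply: (@lifts_block c _ a) => //; case: pa => -> _; split=> //; split; [lia|by []].
- apply: (@lifts_block c _ a') => //; case: pa' => -> _; split=> //; split; [lia|by []].
- apply: (@lifts_block d _ b) => //; case: qb => -> _; split=> //; split; [lia|by []].
- apply: (@lifts_block d _ b') => //; case: qb' => -> _; split=> //; split; [lia|by []].
Qed.

(** No colour occurs three times and Apex occurs at most once, so there is either one Apex vertex or
    two Red and two Green ones. *)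
Lemma clique4_block x y z w :
  x != y -> x != z -> x != w -> y != z -> y != w -> z != w ->
  adj x y -> adj x z -> adj x w -> adj y z -> adj y w -> adj z w ->
  exists k, [/\ 1 <= k <= horizon, x \in block k, y \in block k, z \in block k
              & w \in block k].
Proof.
move=> xy xz xw yz yw zw axy axz axw ayz ayw azw.
have yx := xy; have zx := xz; have wx := xw; have zy := yz; have wy := yw.
have wz := zw; rewrite eq_sym in yx; rewrite eq_sym in zx; rewrite eq_sym in wx.
rewrite eq_sym in zy; rewrite eq_sym in wy; rewrite eq_sym in wz.
have ayx := adj_sym axy; have azx := adj_sym axz; have awx := adj_sym axw.
have azy := adj_sym ayz; have awy := adj_sym ayw; have awz := adj_sym azw.
have [cx hx] := adj_coloured axy; have [cy hy] := adj_coloured ayx.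
have [cz hz] := adj_coloured azx; have [cw hw] := adj_coloured awx.
have apex c d e r u v t : c <> Apex -> d <> Apex -> e <> Apex ->
    coloured Apex r -> coloured c u -> coloured d v -> coloured e t ->
    u != v -> v != t -> t != u ->
    adj r u -> adj r v -> adj r t -> adj u v -> adj v t -> adj t u ->
    exists k, 1 <= k <= horizon /\ {subset [:: r; u; v; t] <= block k}.
  move=> h1 h2 h3 h4 h5 h6 h7 h8 h9 h10 h11 h12 h13 h14 h15 h16.
  have [k [hk *]] := apex_clique h1 h2 h3 h4 h5 h6 h7 h8 h9 h10 h11 h12 h13 h14 h15 h16.
  by exists k; split=> //; apply/(allP (a := mem (block k)))/and5P; split.
have square c d p p' q q' : c <> d -> c <> Apex -> d <> Apex ->
    coloured c p -> coloured c p' -> coloured d q -> coloured d q' ->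
    p != p' -> q != q' -> adj p p' -> adj q q' -> adj p q -> adj p q' ->
    adj p' q -> adj p' q' ->
    exists k, 1 <= k <= horizon /\ {subset [:: p; p'; q; q'] <= block k}.
  move=> h1 h2 h3 h4 h5 h6 h7 h8 h9 h10 h11 h12 h13 h14 h15.
  have [k [hk *]] := square_clique h1 h2 h3 h4 h5 h6 h7 h8 h9 h10 h11 h12 h13 h14 h15.
  by exists k; split=> //; apply/(allP (a := mem (block k)))/and5P; split.
suff [k [hk sub]] : exists k, 1 <= k <= horizon /\
    ({subset [:: x; y; z; w] <= block k}).
  by exists k; split=> //; apply: sub; rewrite !inE eqxx ?orbT.
have perm (s : seq nat) : {subset [:: x; y; z; w] <= s} ->
    (exists k, 1 <= k <= horizon /\ {subset s <= block k}) ->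
    exists k, 1 <= k <= horizon /\ {subset [:: x; y; z; w] <= block k}.
  by move=> sub [k [hk sk]]; exists k; split=> // i /sub /sk.
have p1 : {subset [:: x; y; z; w] <= [:: y; x; z; w]}.
  by move=> i; rewrite !inE => /or4P[] ->; rewrite ?orbT.
have p2 : {subset [:: x; y; z; w] <= [:: z; x; y; w]}.
  by move=> i; rewrite !inE => /or4P[] ->; rewrite ?orbT.
have p3 : {subset [:: x; y; z; w] <= [:: w; x; y; z]}.
  by move=> i; rewrite !inE => /or4P[] ->; rewrite ?orbT.
have p4 : {subset [:: x; y; z; w] <= [:: x; z; y; w]}.
  by move=> i; rewrite !inE => /or4P[] ->; rewrite ?orbT.
have p5 : {subset [:: x; y; z; w] <= [:: x; w; y; z]}.
  by move=> i; rewrite !inE => /or4P[] ->; rewrite ?orbT.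
case: cx hx => hx; case: cy hy => hy; case: cz hz => hz; case: cw hw => hw;
  first
  [ by case: (no_mono_triangle hx hy hz)
  | by case: (no_mono_triangle hx hy hw)
  | by case: (no_mono_triangle hx hz hw)
  | by case: (no_mono_triangle hy hz hw)
  | by case: (no_apex_pair hx hy) | by case: (no_apex_pair hx hz)
  | by case: (no_apex_pair hx hw) | by case: (no_apex_pair hy hz)
  | by case: (no_apex_pair hy hw) | by case: (no_apex_pair hz hw)
  | by apply: (apex _ _ _ _ _ _ _ _ _ _ hx hy hz hw)
  | by apply: (perm [:: y; x; z; w] p1); apply: (apex _ _ _ _ _ _ _ _ _ _ hy hx hz hw)
  | by apply: (perm [:: z; x; y; w] p2); apply: (apex _ _ _ _ _ _ _ _ _ _ hz hx hy hw)
  | by apply: (perm [:: w; x; y; z] p3); apply: (apex _ _ _ _ _ _ _ _ _ _ hw hx hy hz)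
  | by apply: (square _ _ _ _ _ _ _ _ _ hx hy hz hw)
  | by apply: (perm [:: x; z; y; w] p4); apply: (square _ _ _ _ _ _ _ _ _ hx hz hy hw)
  | by apply: (perm [:: x; w; y; z] p5); apply: (square _ _ _ _ _ _ _ _ _ hx hw hy hz) ].
Qed.

(** The three vertices are not all of one colour, so by [coloured_pair] each keeps its label. An
    Apex label is the block index; without Apex, two vertices of one colour carry both labels of the
    block. *)
Lemma block_inter x y z k l :
  x != y -> x != z -> y != z -> 1 <= k <= horizon -> 1 <= l <= horizon ->
  {subset [:: x; y; z] <= block k} -> {subset [:: x; y; z] <= block l} -> k = l.
Proof.
move=> xy xz yz hk hl sk sl.
have k1 : 1 <= k by lia.
have l1 : 1 <= l by lia.
have lft v : v \in [:: x; y; z] -> exists c t s, lifts c k t v /\ lifts c l s v.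
  move=> hv; have /(blockP _ k1)[c [t ht]] := sk v hv.
  have cv : coloured c v by exists t; case: ht.
  by have [s hs] := block_lifts l1 cv (sl v hv); exists c, t, s.
have [|c [t [s [xt xs]]]] := lft x; first by rewrite !inE eqxx.
have [|d [t' [s' [yt ys]]]] := lft y; first by rewrite !inE eqxx orbT.
have [|e [t'' [s'' [zt zs]]]] := lft z; first by rewrite !inE eqxx !orbT.
have cd : c <> d -> t = s /\ t' = s'.
  by move=> n; apply: (coloured_pair n hk hl xt yt xs ys).
have ce : c <> e -> t = s /\ t'' = s''.
  by move=> n; apply: (coloured_pair n hk hl xt zt xs zs).
have de : d <> e -> t' = s' /\ t'' = s''.
  by move=> n; apply: (coloured_pair n hk hl yt zt ys zs).
have n1 : c = d -> t != t' by move=> E; subst; exact: lifts_neq xt yt xy.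
have n2 : c = e -> t != t'' by move=> E; subst; exact: lifts_neq xt zt xz.
have n3 : d = e -> t' != t'' by move=> E; subst; exact: lifts_neq yt zt yz.
case: xt => _ [a1 a2]; case: yt => _ [a3 a4]; case: zt => _ [a5 a6].
case: xs => _ [b1 b2]; case: ys => _ [b3 b4]; case: zs => _ [b5 b6].
by case: c a2 b2 cd ce n1 n2 => a2 b2 cd ce n1 n2; case: d a4 b4 cd de n1 n3 => a4 b4 cd de n1 n3;
  case: e a6 b6 ce de n2 n3 => a6 b6 ce de n2 n3;
  repeat match goal with
  | H : ?u = ?u -> _ |- _ => specialize (H erefl)
  | H : ?u <> ?v -> _ |- _ => have {}H : _ := H ltac:(by [])
  end; lia.
Qed.

End Construction.

(** * Realisation on [n] with universal vertices *)

Lemma card_ord_seq n (s : seq nat) : uniq s -> (forall v, v \in s -> v < n) ->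
  #|[set v : 'I_n | (v : nat) \in s]| = size s.
Proof.
move=> us hs; have sn : all (fun v => v < n) s by apply/allP.
have -> : [set v : 'I_n | (v : nat) \in s] = [set v in pmap insub s].
  apply/setP=> v; rewrite !inE mem_pmap_sub //.
rewrite cardsE (card_uniqP _) ?pmap_sub_uniq //.
by rewrite size_pmap_sub; apply/eqP; rewrite -all_count.
Qed.

Section Realisation.

Variables (rho B n' : nat).
Hypothesis order_le : vertex_count rho B <= n'.+1.

Local Notation n := n'.+1.
Local Notation block := (block rho B).
Local Notation vertex := (vertex rho B).
Local Notation adj := (adj rho B).
Local Notation horizon := (horizon B).

Definition full_graph : {set {set 'I_n}} :=
  graph_of [rel x y : 'I_n | [|| x < rho, y < rho | `[< adj x y >]]].

Lemma full_graphP (x y : 'I_n) : reflect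
  (x != y /\ [\/ x < rho, y < rho | adj x y]) ([set x; y] \in full_graph).
Proof.
rewrite graph_ofP; last first.
  move=> u v /=; rewrite orbCA; congr [|| _, _ | _].
  by apply/asboolP/asboolP; apply: adj_sym.
apply: (iffP andP) => -[xy h]; split=> //.
  by case/or3P: h => [h|h|/asboolP h]; [apply: Or31|apply: Or32|apply: Or33].
by apply/or3P; case: h => h; [apply: Or31|apply: Or32|apply: Or33; apply/asboolP].
Qed.

Definition blockset k := [set v : 'I_n | (v < rho) || ((v : nat) \in block k)].

(** The edge shared by blocks j and j + 1; [inord] never takes its default value here, since
    vertices are below [n]. *)
Definition key_edge j : {set 'I_n} := [set inord (vertex Red j); inord (vertex Green j)].

Lemma inord_vertex c t : (inord (vertex c t) : 'I_n) = vertex c t :> nat.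
Proof. by rewrite inordK // (leq_trans (vertex_lt _ _ _ _)). Qed.

Lemma block_uniq k : 1 <= k -> uniq (block k).
Proof.
move=> k1; have mP : 3 < modulus B Red by rewrite /= /base; lia.
have mQ : 3 < modulus B Green by rewrite /= /base; lia.
have ne c : 3 < modulus B c -> vertex c k.-1 != vertex c k.
  move=> m3; apply/eqP=> /vertex_inj[_]; rewrite -{2}(prednK k1) -addn1.
  rewrite -{1}[k.-1]addn0 => /eqP; rewrite eqn_modDl mod0n modn_small //; lia.
have nc c d t s : c <> d -> vertex c t != vertex d s.
  by move=> cd; apply/eqP=> /vertex_inj[].
by rewrite /= !inE !negb_or (ne Red) // (ne Green) // !nc.
Qed.

Lemma card_blockset k : 1 <= k -> #|blockset k| = rho + 5.
Proof.
move=> k1; have -> : blockset k = [set v : 'I_n | (v : nat) \in iota 0 rho ++ block k].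
  by apply/setP=> v; rewrite !in_set mem_cat mem_iota.
have blk v : v \in block k -> rho <= v < n.
  move=> /(blockP _ _ _ k1)[c [t [-> _]]]; rewrite vertex_ge.
  exact: leq_trans (vertex_lt _ _ _ _) order_le.
have rn : rho <= n.
  have /andP[h1 h2] := blk _ (mem_head _ _); exact: leq_trans h1 (ltnW h2).
rewrite card_ord_seq ?size_cat ?size_iota //.
  rewrite cat_uniq iota_uniq block_uniq // andbT; apply/hasPn=> v /blk.
  by rewrite mem_iota; lia.
move=> v; rewrite mem_cat mem_iota => /orP[|/blk]; lia.
Qed.

Lemma blockset_sub k f : 1 <= k <= horizon -> is_edge f -> f \subset blockset k ->
  f \in full_graph.
Proof.
move=> hk /is_edgeP[x [y [xy ->]]] /subsetP h; apply/full_graphP; split=> //.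
have := h x (set21 _ _); have := h y (set22 _ _).
rewrite !in_set => /orP[hy|hy] /orP[hx|hx]; try by constructor.
by apply: Or33; exists k.
Qed.

Lemma key_edge_edge j : is_edge (key_edge j).
Proof.
rewrite is_edge2 -val_eqE /= !inord_vertex; apply/eqP=> /vertex_inj[]; discriminate.
Qed.

Lemma key_edge_sub j k : j <= horizon -> 1 <= k <= horizon ->
  (key_edge j \subset blockset k) = (j == k) || (j.+1 == k).
Proof.
move=> hj hk; have k1 : 1 <= k by lia.
rewrite subUset !sub1set !in_set !inord_vertex !ltnNge !vertex_ge /=.
apply/andP/idP => [[hP hQ]|h].
  have [|t ht] := block_lifts (c := Red) k1 _ hP; first by exists j.
  have [|s hs] := block_lifts (c := Green) k1 _ hQ; first by exists j.
  have PQ : Red <> Green by [].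
  have kT : k <= horizon by lia.
  have [] := cong_pair PQ hj (lifts_le ht kT) hj (lifts_le hs kT) _ _ _
    (lifts_near ht hs).
  - by case: ht => /vertex_inj[].
  - by case: hs => /vertex_inj[].
  - by rewrite /near; lia.
  - by move=> E _; case: ht => _ [+ _]; rewrite -E; lia.
split.
  by apply: (lifts_block (c := Red) (t := j)) => //; split=> //; split=> //; lia.
by apply: (lifts_block (c := Green) (t := j)) => //; split=> //; split=> //; lia.
Qed.

(** Choose non-universal x, y, z in [S] off [e]. For each further non-universal u, the set x, y, z,
    u is a genuine 4-clique, hence lies in a block; by [block_inter] the block does not depend on
    u. *)
Lemma near_clique_blockset (S e : {set 'I_n}) :
  #|S| = rho + 5 -> is_edge e -> e \subset S ->
  (forall f : {set 'I_n}, is_edge f -> f \subset S -> f != e -> f \in full_graph) ->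
  exists2 k, 1 <= k <= horizon & S = blockset k.
Proof.
move=> cS ee eS hS.
set S0 := [set v in S | rho <= v].
have cS0 : 5 <= #|S0|.
  set U := [set v : 'I_n | v < rho].
  have cU : #|U| <= rho.
    have -> : U = [set v : 'I_n | (v : nat) \in iota 0 (minn rho n)].
      by apply/setP=> v; rewrite !in_set mem_iota; have := ltn_ord v; lia.
    rewrite card_ord_seq ?iota_uniq ?size_iota ?geq_minl // => v.
    by rewrite mem_iota; lia.
  have /subset_leq_card h : S \subset S0 :|: U.
    by apply/subsetP=> v vS; rewrite !inE vS; case: leqP.
  rewrite -(leq_add2l rho) -cS (addnC rho).
  exact: leq_trans h (leq_trans (leq_card_setU _ _) (leq_add (leqnn _) cU)).
(* At least five vertices are not universal, and at most two of them are ends of [e]. *)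
have /card_gt2P[x [y [z [[xD yD zD] [xy yz zx]]]]] : 2 < #|S0 :\: e|.
  have h := subset_leq_card (subsetIr S0 e); rewrite (eqP ee) in h.
  by rewrite cardsD; apply: leq_trans (leq_sub cS0 h).
have adjD u v : u \in S0 :\: e -> v \in S0 -> u != v -> adj u v.
  rewrite !in_set => /andP[ue /andP[uS ur]] /andP[vS vr] uv.
  have /full_graphP[_ []] : [set u; v] \in full_graph => //; try by rewrite ltnNge ?ur ?vr.
  apply: hS; rewrite ?is_edge2 //; first by apply/subsetP=> w /set2P[] ->.
  by apply: contraNneq ue => <-; rewrite set21.
have inS0 u : u \in S0 :\: e -> u \in S0 by rewrite in_setD => /andP[].
have adj_xy : adj x y by apply: adjD => //; apply: inS0.
have adj_xz : adj x z by apply: adjD; rewrite 1?eq_sym //; apply: inS0.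
have adj_yz : adj y z by apply: adjD => //; apply: inS0.
have blk u : u \in S0 -> u != x -> u != y -> u != z -> exists k,
    [/\ 1 <= k <= horizon, (u : nat) \in block k
      & {subset [:: x : nat; y : nat; z : nat] <= block k}].
  move=> uS ux uy uz.
  have [] := @clique4_block rho B x y z u => //; rewrite 1?eq_sym //;
    try (by apply: adjD; rewrite // eq_sym).
  move=> k [hk hx hy hz hu]; exists k; split=> //.
  by apply/(allP (a := mem (block k)))/and4P; split.
have [u uS /and3P[ux uy uz]] : exists2 u, u \in S0 & [&& u != x, u != y & u != z].
  have /card_gt0P[u] : 0 < #|S0 :\: [set x; y; z]|.
    have h : #|S0 :&: [set x; y; z]| <= 3.
      apply: leq_trans (subset_leq_card (subsetIr S0 _)) _.
      by rewrite -setUA cardsU1 cards2; case: (_ \notin _); case: (_ != _).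
    by rewrite cardsD subn_gt0; apply: leq_ltn_trans h _; apply: leq_trans cS0.
  rewrite in_setD => /andP[uxyz uS]; exists u => //.
  by rewrite !in_setU !in_set1 !negb_or -andbA in uxyz.
have [k [hk _ hxyz]] := blk u uS ux uy uz.
exists k => //; apply/eqP; rewrite eqEcard cS card_blockset; last by case/andP: hk.
rewrite leqnn andbT; apply/subsetP=> v vS; rewrite in_set.
case: ltnP => //= vr; have vS0 : v \in S0 by rewrite in_set vS.
have [->|vx] := eqVneq v x; first by apply: hxyz; rewrite !inE eqxx.
have [->|vy] := eqVneq v y; first by apply: hxyz; rewrite !inE eqxx orbT.
have [->|vz] := eqVneq v z; first by apply: hxyz; rewrite !inE eqxx !orbT.
have [l [hl hv hxyz']] := blk v vS0 vx vy vz.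
by rewrite (block_inter _ _ _ hk hl hxyz hxyz') // eq_sym.
Qed.

Lemma long_running_graph : exists (G : {set {set 'I_n}}) t,
  [/\ is_graph G, is_sat_time (rho + 5) G t & horizon <= t].
Proof.
apply: (@chain_sat_time _ _ _ full_graph blockset key_edge).
- exact: graph_of_graph.
- by move=> k hk; apply: card_blockset; lia.
- exact: blockset_sub.
- by move=> j _; apply: key_edge_edge.
- exact: key_edge_sub.
- exact: near_clique_blockset.
Qed.

End Realisation.

(** * Asymptotics *)

(** [B] is the integer square root of m / 124. The three moduli add up to 48B^2 + 56B + 20, which is
    at most 124B^2 for B >= 1. *)
Lemma sqrt_scale m : 124 <= m -> exists B,
  [/\ 1 <= B, 124 * B ^ 2 <= m & m < 124 * B.+1 ^ 2].
Proof.
move=> hm; have [h1 h2] := Nat.sqrt_spec (m %/ 124) (le_0_n _).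
have := leq_trunc_div m 124; have := ltn_ceil m (isT : 0 < 124).
have : 1 <= m %/ 124 by rewrite divn_gt0.
move: (m %/ 124) (Nat.sqrt (m %/ 124)) h1 h2 => q B h1 h2 q1 hq1 hq2.
by exists B; split; nia.
Qed.

Section RealBound.

Local Open Scope R_scope.

(** As 992 < 32^2, n^(3/2) is at most 992 B^2 times 32B, that is 1984 times 16B^3, and [horizon B]
    >= 16B^3. *)
Lemma horizon_ge (n B : nat) : (n <= 992 * B ^ 2)%N ->
  / 1984 * INR n * sqrt (INR n) <= INR (horizon B).
Proof.
move=> hn; have hB := pos_INR B; have n0 := pos_INR n.
have hnR : INR n <= 992 * (INR B * INR B).
  have : INR n <= INR (992 * B ^ 2) by apply: le_INR; lia.
  by rewrite -mulnn !mult_INR (_ : INR 992 = 992) ?INR_IZR_INZ.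
have hs : sqrt (INR n) <= 32 * INR B.
  rewrite -(sqrt_square (32 * INR B)); last by lra.
  by apply: sqrt_le_1_alt; nra.
have s0 := sqrt_pos (INR n).
have hT : 16 * (INR B * INR B * INR B) <= INR (horizon B).
  have -> : 16 * (INR B * INR B * INR B) = INR (16 * (B * B * B)).
    by rewrite !mult_INR (_ : INR 16 = 16) ?INR_IZR_INZ.
  by apply: le_INR; rewrite /horizon /base; nia.
have := Rmult_le_compat _ _ _ _ n0 s0 hnR hs; lra.
Qed.

End RealBound.

Theorem theorem1 :
  (forall n : nat, 2 <= n -> is_tau_max n 3 (ceil_log2 n.-1)) /\
  (forall n : nat, 3 <= n -> is_tau_max n 4 (n - 3)) /\
  (forall r : nat, 5 <= r ->
     exists (c : R) (n0 : nat), Rlt 0 c /\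
       forall n : nat, n0 <= n ->
         exists (G : {set {set 'I_n}}) (t : nat),
           is_graph G /\ is_sat_time r G t /\
           Rle (Rmult (Rmult c (INR n)) (sqrt (INR n))) (INR t)).
Proof.
split; first exact: tau_max_3.
split; first exact: tau_max_4.
(* The threshold makes n - (r - 5) at least 124 and at least n / 2. *)
move=> r r5; exists (Rinv (IZR 1984)), (2 * r + 124); split; first by lra.
case=> [|n'] hn; first by lia.
have [|B [B1 hB hB']] := @sqrt_scale (n'.+1 - (r - 5)); first by lia.
have hv : vertex_count (r - 5) B <= n'.+1.
  by rewrite /vertex_count /modulus /base; nia.
have [G [t [gG ht hT]]] := long_running_graph hv.
rewrite subnK // in ht; exists G, t; split=> //; split=> //.
apply: Rle_trans (le_INR _ _ _); last exact/leP/hT.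
(* n <= 2(n - (r - 5)) < 248(B + 1)^2 <= 992B^2. *)
by apply: horizon_ge; nia.
Qed.
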